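(* Let $X$ be a set and let $\Phi\subseteq\mathbf{k}\mathfrak{M}(X)$ be a set of (multilinear) OPIs. Given a unital $\mathbf{k}$-algebra $A$, the quotient operated algebra $$\mathcal{F}^{\Phi\text{-}\mathrm{Alg}}_{\mathrm{uAlg}}(A):=\mathcal{F}^{\mathrm{uOpAlg}}_{\mathrm{uAlg}}(A)/\langle R_\Phi(A)\rangle_{\mathrm{uOpAlg}}$$ is the free $\Phi$-algebra generated by the unital algebra $A$.
   Context: $\mathbf{k}$ is a field. A unital operated algebra is a unital $\mathbf{k}$-algebra $B$ with a $\mathbf{k}$-linear operator $P_B:B\to B$; morphisms are unital algebra homomorphisms commuting with the operators. An operated ideal is an ideal closed under the operator, and $\langle S\rangle_{\mathrm{uOpAlg}}$ is the operated ideal generated by $S$. $\mathcal{F}^{\mathrm{uOpAlg}}_{\mathrm{uAlg}}$ is the left adjoint of the forgetful functor from unital operated algebras to unital algebras; so $\mathcal{F}^{\mathrm{uOpAlg}}_{\mathrm{uAlg}}(A)$ is the free unital operated algebra on the unital algebra $A$. $\mathbf{k}\mathfrak{M}(X)$ is the free unital operated algebra on the set $X$ ($\mathfrak{M}(X)$ being the free operated monoid on $X$, i.e. the bracketed words in $X$). An OPI is an element $\phi=\phi(x_1,\dots,x_n)\in\mathbf{k}\mathfrak{M}(X)$, $n\ge1$, $x_i\in X$; it is multilinear if it is linear in each $x_i$. For elements $r_1,\dots,r_n$ of a unital operated algebra $B$, $\phi(r_1,\dots,r_n)\in B$ is the image of $\phi$ under the morphism of unital operated algebras $\mathbf{k}\mathfrak{M}(X)\to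 B$ extending a map $X\to B$ with $x_i\mapsto r_i$. A $\Phi$-algebra is a unital operated algebra $B$ with $\phi(r_1,\dots,r_n)=0$ for all $\phi\in\Phi$ and all $r_i\in B$; these form a full subcategory of unital operated algebras. Put $$R_\Phi(A):=\{\phi(u_1,\dots,u_n)\mid u_1,\dots,u_n\in\mathcal{F}^{\mathrm{uOpAlg}}_{\mathrm{uAlg}}(A),\ \phi(x_1,\dots,x_n)\in\Phi\}.$$ ''Free $\Phi$-algebra generated by $A$'' means the value at $A$ of the left adjoint of the forgetful functor from $\Phi$-algebras to unital algebras: every unital algebra homomorphism from $A$ to a $\Phi$-algebra $B$ extends uniquely, along the canonical homomorphism from $A$, to a morphism of unital operated algebras into $B$. *)

(* Defs.v *)
From HB Require Import structures.
From mathcomp Require Import all_boot all_algebra.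
From mathcomp Require Import finmap monalg.
From mathcomp Require Import boolp classical_sets.

Set Implicit Arguments.
Unset Strict Implicit.
Unset Printing Implicit Defensive.

Import GRing.Theory.
Local Open Scope ring_scope.
Local Open Scope quotient_scope.

(* MathComp's algType excludes the zero ring, but a quotient by an operated
   ideal may well be zero; unital algebras are therefore built over pzRingType.
   HB cannot join PzRing and Lmodule below algType, so the scaling is part of
   the mixin and the Lmodule structure is derived from it. *)
HB.mixin Record isPzAlgebra (k : fieldType) A of GRing.PzRing A := {
  pzscale : k -> A -> A;
  pzscalerA : forall a b x, pzscale a (pzscale b x) = pzscale (a * b) x;
  pzscale1r : left_id 1 pzscale;
  pzscalerDr : right_distributive pzscale +%R;
  pzscalerDl : forall x, {morph pzscale^~ x : a b / a + b};
  pzscaleAl : forall a x y, pzscale a (x * y) = pzscale a x * y;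
  pzscaleAr : forall a x y, pzscale a (x * y) = x * pzscale a y
}.

#[short(type="pzAlgType")]
HB.structure Definition PzAlgebra (k : fieldType) :=
  {A of GRing.PzRing A & isPzAlgebra k A}.

HB.instance Definition _ (k : fieldType) (A : pzAlgType k) :=
  GRing.Zmodule_isLmodule.Build k (PzAlgebra.sort A)
    (@pzscalerA k A) (@pzscale1r k A) (@pzscalerDr k A) (@pzscalerDl k A).

Lemma pzscalerAl (k : fieldType) (A : pzAlgType k) (a : k) (x y : A) :
  a *: (x * y) = (a *: x) * y.
Proof. exact: pzscaleAl. Qed.

Lemma pzscalerAr (k : fieldType) (A : pzAlgType k) (a : k) (x y : A) :
  a *: (x * y) = x * (a *: y).
Proof. exact: pzscaleAr. Qed.

HB.mixin Record hasOperator (k : fieldType) B of PzAlgebra k B := {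
  oper : B -> B;
  oper_pzlinear :
    forall a x y, oper (pzscale a x + y) = pzscale a (oper x) + oper y
}.

#[short(type="opAlgType")]
HB.structure Definition OpAlgebra (k : fieldType) :=
  {B of PzAlgebra k B & hasOperator k B}.

HB.instance Definition _ (k : fieldType) (B : opAlgType k) :=
  GRing.Lmodule.copy (OpAlgebra.sort B) (PzAlgebra.sort B).

Fact oper_is_linear (k : fieldType) (B : opAlgType k) : linear (@oper k B).
Proof. exact: oper_pzlinear. Qed.

HB.instance Definition _ (k : fieldType) (B : opAlgType k) :=
  GRing.isLinear.Build k B B *:%R (@oper k B) (@oper_is_linear k B).

HB.mixin Record isPzScalable (k : fieldType) (A B : pzAlgType k)
    (f : A -> B) := {
  pzscalable_subproof : scalable f
}.

HB.structure Definition AlgMorphism (k : fieldType) (A B : pzAlgType k) :=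
  {f of @GRing.RMorphism A B f & isPzScalable k A B f}.

Notation "{ 'algmorphism' A -> B }" := (@AlgMorphism.type _ A%type B%type)
  (at level 0, A at level 98, B at level 99,
   format "{ 'algmorphism'  A  ->  B }") : type_scope.

HB.instance Definition _ (k : fieldType) (A B : pzAlgType k)
  (f : {algmorphism A -> B}) :=
  GRing.isScalable.Build k A B *:%R (AlgMorphism.sort f)
    (@pzscalable_subproof k A B f).

Fact comp_pzscalable (k : fieldType) (A B C : pzAlgType k)
  (g : {algmorphism B -> C}) (f : {algmorphism A -> B}) : scalable (g \o f).
Proof. by move=> a x; rewrite /= !linearZ. Qed.

HB.instance Definition _ (k : fieldType) (A B C : pzAlgType k)
  (g : {algmorphism B -> C}) (f : {algmorphism A -> B}) :=
  isPzScalable.Build k A C (g \o f) (comp_pzscalable g f).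

HB.mixin Record commutesWithOper (k : fieldType) (A B : opAlgType k)
    (f : A -> B) := {
  morph_oper : {morph f : x / oper x >-> oper x}
}.

HB.structure Definition OpMorphism (k : fieldType) (A B : opAlgType k) :=
  {f of @AlgMorphism k A B f & commutesWithOper k A B f}.

Notation "{ 'opmorphism' A -> B }" := (@OpMorphism.type _ A%type B%type)
  (at level 0, A at level 98, B at level 99,
   format "{ 'opmorphism'  A  ->  B }") : type_scope.

HB.instance Definition _ (k : fieldType) (A B : opAlgType k)
  (f : {opmorphism A -> B}) :=
  GRing.isScalable.Build k A B *:%R (OpMorphism.sort f)
    (@pzscalable_subproof k A B f).

HB.instance Definition _ (k : fieldType) (A B C : opAlgType k)
  (g : {opmorphism B -> C}) (f : {opmorphism A -> B}) :=
  AlgMorphism.on (g \o f).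

Fact comp_morph_oper (k : fieldType) (A B C : opAlgType k)
  (g : {opmorphism B -> C}) (f : {opmorphism A -> B}) :
  {morph g \o f : x / oper x >-> oper x}.
Proof. by move=> x /=; rewrite !morph_oper. Qed.

HB.instance Definition _ (k : fieldType) (A B C : opAlgType k)
  (g : {opmorphism B -> C}) (f : {opmorphism A -> B}) :=
  commutesWithOper.Build k A C (g \o f) (comp_morph_oper g f).

Section OpIdeal.
Variables (k : fieldType) (B : opAlgType k).

Record is_opideal (I : set B) : Prop := IsOpIdeal {
  opideal0 : I 0;
  opidealD : forall x y, I x -> I y -> I (x + y);
  opidealMl : forall a x, I x -> I (a * x);
  opidealMr : forall a x, I x -> I (x * a);
  opideal_oper : forall x, I x -> I (oper x)
}.

Record opideal := OpIdeal {
  opideal_set :> B -> Prop;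
  opidealP : is_opideal opideal_set
}.

Definition opideal_span_set (S : set B) : set B :=
  [set x | forall I : set B, is_opideal I -> (S `<=` I)%classic -> I x].

Fact opideal_span_subproof (S : set B) : is_opideal (opideal_span_set S).
Proof.
split=> [I hI _|x y hx hy I hI SI|a x hx I hI SI|a x hx I hI SI|x hx I hI SI].
- exact: opideal0 hI.
- by apply: (opidealD hI); [exact: hx | exact: hy].
- by apply: (opidealMl hI); exact: hx.
- by apply: (opidealMr hI); exact: hx.
- by apply: (opideal_oper hI); exact: hx.
Qed.

Definition opideal_span (S : set B) : opideal :=
  OpIdeal (opideal_span_subproof S).

Definition opideal_pred (I : opideal) : {pred B} := fun x => `[< I x >].

Fact opideal_zmod_closed (I : opideal) : zmod_closed (opideal_pred I).
Proof.
split=> [|x y /asboolP Ix /asboolP Iy]; apply/asboolP.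
  exact: opideal0 (opidealP I).
apply: (opidealD (opidealP I)) => //.
by rewrite -mulN1r; apply: (opidealMl (opidealP I)).
Qed.

HB.instance Definition _ (I : opideal) :=
  GRing.isZmodClosed.Build B (opideal_pred I) (opideal_zmod_closed I).

End OpIdeal.

Section OpQuotient.
Variables (k : fieldType) (B : opAlgType k) (I : opideal B).

Definition opquot : Type := {ideal_quot (opideal_pred I : zmodClosed B)}.

HB.instance Definition _ := GRing.Zmodule.on opquot.
HB.instance Definition _ := EqQuotient.on opquot.

Definition opquot_pi (x : B) : opquot := \pi_opquot x.

Lemma opquot_piP (x y : B) : opquot_pi x = opquot_pi y <-> I (x - y).
Proof.
split=> [/eqP|h].
  by rewrite -[_ == _]/(\pi_({ideal_quot (opideal_pred I : zmodClosed B)}) x == \pi y)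
    -Quotient.idealrBE => /asboolP.
apply/eqP.
by rewrite -[_ == _]/(\pi_({ideal_quot (opideal_pred I : zmodClosed B)}) x == \pi y)
  -Quotient.idealrBE; apply/asboolP.
Qed.

Lemma opquot_reprK (q : opquot) : opquot_pi (repr q) = q.
Proof. exact: reprK. Qed.

Fact opquot_repr (x : B) : I (repr (opquot_pi x) - x).
Proof. by apply/opquot_piP; rewrite opquot_reprK. Qed.

Fact opquot_piB : {morph opquot_pi : x y / x - y}.
Proof.
move=> x y; rewrite /opquot_pi.
by rewrite -[\pi_opquot _]/(\pi_({ideal_quot (opideal_pred I : zmodClosed B)}) _) !piE.
Qed.

HB.instance Definition _ :=
  GRing.isZmodMorphism.Build B opquot opquot_pi opquot_piB.

Definition opquot_one : opquot := opquot_pi 1.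
Definition opquot_mul (p q : opquot) : opquot := opquot_pi (repr p * repr q).
Definition opquot_scale (a : k) (q : opquot) : opquot := opquot_pi (a *: repr q).
Definition opquot_oper (q : opquot) : opquot := opquot_pi (oper (repr q)).

Fact opideal_scale a x : I x -> I (a *: x).
Proof.
by rewrite -[x]mul1r pzscalerAl mul1r => ?; apply: (opidealMl (opidealP I)).
Qed.

Fact opquot_piM (x y : B) :
  opquot_mul (opquot_pi x) (opquot_pi y) = opquot_pi (x * y).
Proof.
apply/opquot_piP.
set x' := repr _; set y' := repr _.
have -> : x' * y' - x * y = (x' - x) * y' + x * (y' - y).
  by rewrite mulrBl mulrBr addrA subrK.
apply: (opidealD (opidealP I)).
  by apply: (opidealMr (opidealP I)); exact: opquot_repr.
by apply: (opidealMl (opidealP I)); exact: opquot_repr.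
Qed.

Fact opquot_piZ a (x : B) : opquot_scale a (opquot_pi x) = opquot_pi (a *: x).
Proof.
by apply/opquot_piP; rewrite -scalerBr; apply: opideal_scale; exact: opquot_repr.
Qed.

Fact opquot_pi_oper (x : B) :
  opquot_oper (opquot_pi x) = opquot_pi (oper x).
Proof.
apply/opquot_piP; rewrite -[_ - _]linearB.
by apply: (opideal_oper (opidealP I)); exact: opquot_repr.
Qed.

Fact opquot_mulA : associative opquot_mul.
Proof.
move=> p q r; rewrite -[p]opquot_reprK -[q]opquot_reprK -[r]opquot_reprK.
by rewrite !opquot_piM mulrA.
Qed.

Fact opquot_mul1 : left_id opquot_one opquot_mul.
Proof. by move=> p; rewrite -[p]opquot_reprK opquot_piM mul1r. Qed.

Fact opquot_mulr1 : right_id opquot_one opquot_mul.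
Proof. by move=> p; rewrite -[p]opquot_reprK opquot_piM mulr1. Qed.

Fact opquot_mulDl : left_distributive opquot_mul +%R.
Proof.
move=> p q r; rewrite -[p]opquot_reprK -[q]opquot_reprK -[r]opquot_reprK.
by rewrite -raddfD !opquot_piM mulrDl raddfD.
Qed.

Fact opquot_mulDr : right_distributive opquot_mul +%R.
Proof.
move=> p q r; rewrite -[p]opquot_reprK -[q]opquot_reprK -[r]opquot_reprK.
by rewrite -raddfD !opquot_piM mulrDr raddfD.
Qed.

HB.instance Definition _ := GRing.Zmodule_isPzRing.Build opquot
  opquot_mulA opquot_mul1 opquot_mulr1 opquot_mulDl opquot_mulDr.

Fact opquot_scaleA a b q :
  opquot_scale a (opquot_scale b q) = opquot_scale (a * b) q.
Proof. by rewrite -[q]opquot_reprK !opquot_piZ scalerA. Qed.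

Fact opquot_scale1 : left_id 1 opquot_scale.
Proof. by move=> q; rewrite -[q]opquot_reprK opquot_piZ scale1r. Qed.

Fact opquot_scaleDr : right_distributive opquot_scale +%R.
Proof.
move=> a p q; rewrite -[p]opquot_reprK -[q]opquot_reprK.
by rewrite -raddfD !opquot_piZ scalerDr raddfD.
Qed.

Fact opquot_scaleDl q : {morph opquot_scale^~ q : a b / a + b}.
Proof.
by move=> a b; rewrite -[q]opquot_reprK !opquot_piZ scalerDl raddfD.
Qed.

Fact opquot_scaleAl a (p q : opquot) :
  opquot_scale a (p * q) = opquot_scale a p * q.
Proof.
rewrite -[p]opquot_reprK -[q]opquot_reprK -![_ * _]/(opquot_mul _ _).
by rewrite !(opquot_piM, opquot_piZ) pzscalerAl.
Qed.

Fact opquot_scaleAr a (p q : opquot) :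
  opquot_scale a (p * q) = p * opquot_scale a q.
Proof.
rewrite -[p]opquot_reprK -[q]opquot_reprK -![_ * _]/(opquot_mul _ _).
by rewrite !(opquot_piM, opquot_piZ) pzscalerAr.
Qed.

HB.instance Definition _ := isPzAlgebra.Build k opquot
  opquot_scaleA opquot_scale1 opquot_scaleDr opquot_scaleDl
  opquot_scaleAl opquot_scaleAr.

HB.instance Definition _ :=
  GRing.Lmodule.copy opquot (PzAlgebra.sort (opquot : pzAlgType k)).

Fact opquot_oper_linear a (p q : opquot) :
  opquot_oper (pzscale a p + q) = pzscale a (opquot_oper p) + opquot_oper q.
Proof.
rewrite -[p]opquot_reprK -[q]opquot_reprK.
rewrite -![pzscale _ _]/(opquot_scale _ _) opquot_piZ -raddfD !opquot_pi_oper.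
by rewrite opquot_piZ -raddfD linearP.
Qed.

HB.instance Definition _ := hasOperator.Build k opquot opquot_oper_linear.

Fact opquot_pi_monoid : monoid_morphism opquot_pi.
Proof. by split=> // x y; rewrite -opquot_piM. Qed.

HB.instance Definition _ :=
  GRing.isMonoidMorphism.Build B opquot opquot_pi opquot_pi_monoid.

Fact opquot_pi_scalable : scalable opquot_pi.
Proof. by move=> a x; rewrite -opquot_piZ. Qed.

HB.instance Definition _ :=
  isPzScalable.Build k B opquot opquot_pi opquot_pi_scalable.

Fact opquot_pi_morph_oper : {morph opquot_pi : x / oper x >-> oper x}.
Proof. by move=> x; rewrite -opquot_pi_oper. Qed.

HB.instance Definition _ :=
  commutesWithOper.Build k B opquot opquot_pi opquot_pi_morph_oper.

End OpQuotient.

Section BracketedWords.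
Variable X : choiceType.

(* A bracketed word is a finite product of letters, a letter being either an
   element of X or a bracketed word enclosed in brackets. *)
Inductive bletter : Type :=
  | BVar of X
  | BBracket of seq bletter.

Fixpoint tree_of_bletter (l : bletter) : GenTree.tree X :=
  match l with
  | BVar x => GenTree.Leaf x
  | BBracket s => GenTree.Node 0 (map tree_of_bletter s)
  end.

Fixpoint bletter_of_tree (t : GenTree.tree X) : bletter :=
  match t with
  | GenTree.Leaf x => BVar x
  | GenTree.Node _ s => BBracket (map bletter_of_tree s)
  end.

Fixpoint bletter_ind' (P : bletter -> Prop) (Pvar : forall x, P (BVar x))
    (Pbr : forall s, foldr (fun l Q => P l /\ Q) True s -> P (BBracket s))
    (l : bletter) : P l :=
  match l with
  | BVar x => Pvar x
  | BBracket s => Pbr s ((fix F (s : seq bletter) :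
        foldr (fun l Q => P l /\ Q) True s :=
      match s with
      | [::] => I
      | l' :: s' => conj (bletter_ind' Pvar Pbr l') (F s')
      end) s)
  end.

Fact tree_of_bletterK : cancel tree_of_bletter bletter_of_tree.
Proof.
elim/bletter_ind' => [//|s IHs] /=; congr BBracket.
by elim: s IHs => //= l s IH [-> /IH ->].
Qed.

HB.instance Definition _ := Choice.copy bletter (can_type tree_of_bletterK).

Definition bword := {fmonom bletter}.
HB.instance Definition _ := MonomialDef.on bword.

Definition bword_var (x : X) : bword := fmu (BVar x).
Definition bword_bracket (w : bword) : bword := fmu (BBracket w).

Fixpoint bletter_vars (l : bletter) : seq X :=
  match l with
  | BVar x => [:: x]
  | BBracket s => flatten (map bletter_vars s)
  end.

Definition bword_vars (w : bword) : seq X :=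
  flatten [seq bletter_vars l | l <- (w : seq bletter)].

Section WordEval.
Variables (k : fieldType) (B : opAlgType k) (v : X -> B).

Fixpoint bletter_eval (l : bletter) : B :=
  match l with
  | BVar x => v x
  | BBracket s => oper (foldr (fun l' b => bletter_eval l' * b) 1 s)
  end.

Definition bword_eval (w : bword) : B :=
  foldr (fun l b => bletter_eval l * b) 1 (w : seq bletter).

Lemma bword_eval1 : bword_eval mone = 1.
Proof. by rewrite /bword_eval fm1. Qed.

Lemma bword_evalM (w1 w2 : bword) :
  bword_eval (mmul w1 w2) = bword_eval w1 * bword_eval w2.
Proof.
rewrite /bword_eval fmM foldr_cat.
by elim: (w1 : seq _) => [|l s /= ->]; rewrite ?mul1r ?mulrA.
Qed.

Lemma bword_eval_var x : bword_eval (bword_var x) = v x.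
Proof. by rewrite /bword_eval fmU /= mulr1. Qed.

Lemma bword_eval_bracket w : bword_eval (bword_bracket w) = oper (bword_eval w).
Proof. by rewrite /bword_eval fmU /= mulr1. Qed.

End WordEval.
End BracketedWords.

Section LinearExtension.
Variables (k : fieldType) (K : choiceType) (V : lmodType k) (h : K -> V).

Definition malg_ext (g : {malg k[K]}) : V := \sum_(w <- msupp g) g@_w *: h w.

Fact malg_extEw (d : {fset K}) g : (msupp g `<=` d)%fset ->
  malg_ext g = \sum_(w <- d) g@_w *: h w.
Proof.
move=> le; rewrite [LHS](big_fset_incl _ le) => //= x xd /mcoeff_outdom ->.
by rewrite scale0r.
Qed.

Fact malg_ext_linear : linear malg_ext.
Proof.
move=> a f g; pose d := (msupp f `|` msupp g)%fset.
have le1 : (msupp f `<=` d)%fset by exact: fsubsetUl.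
have le2 : (msupp g `<=` d)%fset by exact: fsubsetUr.
have le3 : (msupp (a *: f + g) `<=` d)%fset.
  apply: fsubset_trans (msuppD_le _ _) _.
  by rewrite fsubUset le2 (fsubset_trans (msuppZ_le _ _) le1).
rewrite (malg_extEw le1) (malg_extEw le2) (malg_extEw le3) scaler_sumr -big_split.
by apply: eq_bigr => w _; rewrite mcoeffD mcoeffZ scalerDl scalerA.
Qed.

HB.instance Definition _ :=
  GRing.isLinear.Build k {malg k[K]} V *:%R malg_ext malg_ext_linear.

Lemma malg_extU c w : malg_ext << c *g w >> = c *: h w.
Proof. by rewrite (malg_extEw msuppU_le) big_seq_fset1 mcoeffUU. Qed.

End LinearExtension.

Section FreeOpAlgebra.
Variables (k : fieldType) (X : choiceType).

Definition freeop : Type := {malg k[bword X]}.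

HB.instance Definition _ := GRing.NzRing.on freeop.
HB.instance Definition _ := GRing.Lmodule.on freeop.

Fact freeop_scaleAl (a : k) (f g : freeop) : a *: (f * g) = a *: f * g.
Proof. exact: fgscaleAl. Qed.

Fact freeop_scaleAr (a : k) (f g : freeop) : a *: (f * g) = f * (a *: g).
Proof.
apply/malgP => w; rewrite mcoeffZ mcoeffMl.
rewrite (mcoeffMlw w (fsubset_refl _) (@msuppZ_le _ _ a g)) mulr_sumr.
apply: eq_bigr => w1 _; rewrite mulr_sumr; apply: eq_bigr => w2 _.
by rewrite mcoeffZ -mulrnAr mulrnAr mulrCA mulrnAr.
Qed.

HB.instance Definition _ := isPzAlgebra.Build k freeop
  (@scalerA k freeop) (@scale1r k freeop) (@scalerDr k freeop)
  (fun x a b => scalerDl x a b) freeop_scaleAl freeop_scaleAr.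

Definition freeop_oper : freeop -> freeop :=
  malg_ext (fun w => << bword_bracket w >> : freeop).

HB.instance Definition _ := hasOperator.Build k freeop
  (malg_ext_linear (fun w => << bword_bracket w >> : freeop)).

Definition freeop_var (x : X) : freeop := << bword_var x >>.

Section Eval.
Variables (B : opAlgType k) (v : X -> B).

(* The morphism of unital operated algebras extending v, see freeop_eval_uniq. *)
Definition freeop_eval : freeop -> B := malg_ext (bword_eval v).

Lemma freeop_eval_var x : freeop_eval (freeop_var x) = v x.
Proof. by rewrite /freeop_eval malg_extU scale1r bword_eval_var. Qed.

Fact freeop_eval_zmod : zmod_morphism freeop_eval.
Proof. exact: raddfB. Qed.

HB.instance Definition _ :=
  GRing.isZmodMorphism.Build freeop B freeop_eval freeop_eval_zmod.

Fact freeop_eval_monoid : monoid_morphism freeop_eval.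
Proof.
split; first by rewrite /freeop_eval malg_extU scale1r bword_eval1.
move=> f g; rewrite [f * g]malgME.
rewrite -[freeop_eval f]/(\sum_(w <- msupp f) f@_w *: bword_eval v w).
rewrite -[freeop_eval g]/(\sum_(w <- msupp g) g@_w *: bword_eval v w).
rewrite mulr_suml raddf_sum; apply: eq_bigr => w1 _.
rewrite mulr_sumr raddf_sum; apply: eq_bigr => w2 _.
rewrite [LHS]malg_extU bword_evalM.
by rewrite -pzscalerAl -pzscalerAr scalerA.
Qed.

HB.instance Definition _ :=
  GRing.isMonoidMorphism.Build freeop B freeop_eval freeop_eval_monoid.

Fact freeop_eval_scalable : scalable freeop_eval.
Proof. by move=> a f; rewrite /freeop_eval linearZ. Qed.

HB.instance Definition _ :=
  isPzScalable.Build k freeop B freeop_eval freeop_eval_scalable.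

Fact freeop_eval_oper : {morph freeop_eval : f / oper f >-> oper f}.
Proof.
move=> f.
rewrite -[freeop_eval f]/(\sum_(w <- msupp f) f@_w *: bword_eval v w).
rewrite -[oper f]/(\sum_(w <- msupp f) f@_w *: << bword_bracket w >>).
rewrite !raddf_sum; apply: eq_bigr => w _.
rewrite [LHS]freeop_eval_scalable [RHS]linearZ; congr (_ *: _).
by rewrite [LHS]malg_extU scale1r bword_eval_bracket.
Qed.

HB.instance Definition _ :=
  commutesWithOper.Build k freeop B freeop_eval freeop_eval_oper.

Fact freeop_word_ind (P : freeop -> Prop) : P 1 ->
  (forall f g, P f -> P g -> P (f * g)) -> (forall x, P (freeop_var x)) ->
  (forall f, P f -> P (oper f)) -> forall w : bword X, P << w >>.
Proof.
move=> P1 PM Pv Po.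
suff Pl (l : bletter X) : P << fmu l : bword X >>.
  have Ps (s : seq (bletter X)) : P << FMonom s : bword X >>.
    elim: s => [|l s IHs]; first by rewrite -fmoneE; exact: P1.
    have -> : FMonom (l :: s) = mmul (fmu l) (FMonom s) :> bword X.
      by rewrite -[RHS]fmK fmM fmU.
    have -> : << mmul (fmu l) (FMonom s : bword X) >> =
              << fmu l : bword X >> * << FMonom s : bword X >> :> freeop.
      by rewrite [RHS]fgmulUU mulr1.
    exact: PM.
  by move=> w; rewrite -(fmK w); exact: Ps.
elim/bletter_ind': l => [x|s IHs]; first exact: Pv.
have -> : << fmu (BBracket s) : bword X >> = oper (<< FMonom s >> : freeop).
  by rewrite [RHS]malg_extU scale1r.
apply: Po; elim: s IHs => [_|l s IHs /= [Pl Ps]].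
  by rewrite -fmoneE; exact: P1.
have -> : FMonom (l :: s) = mmul (fmu l) (FMonom s) :> bword X.
  by rewrite -[RHS]fmK fmM fmU.
have -> : << mmul (fmu l) (FMonom s : bword X) >> =
          << fmu l : bword X >> * << FMonom s : bword X >> :> freeop.
  by rewrite [RHS]fgmulUU mulr1.
by apply: PM => //; exact: IHs.
Qed.

Lemma freeop_eval_uniq (g : {opmorphism freeop -> B}) :
  (forall x, g (freeop_var x) = v x) -> g =1 freeop_eval.
Proof.
move=> gv f; rewrite [f]monalgE !raddf_sum; apply: eq_bigr => w _.
have -> : << f@_w *g w >> = f@_w *: << w >> :> freeop.
  by apply/malgP => w'; rewrite mcoeffZ !mcoeffU mulrnAr mulr1.
rewrite [LHS]linearZ [RHS]freeop_eval_scalable; congr (_ *: _).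
apply: (@freeop_word_ind (fun f => g f = freeop_eval f)) => [|p q|x|p] /=.
- by rewrite !rmorph1.
- by move=> Ep Eq; rewrite [LHS]rmorphM [RHS]rmorphM; congr (_ * _).
- by rewrite gv freeop_eval_var.
- by move=> Ep; rewrite [LHS]morph_oper [RHS]morph_oper Ep.
Qed.

End Eval.
End FreeOpAlgebra.

Section OpQuotientLift.
Variables (k : fieldType) (B C : opAlgType k) (h : {opmorphism B -> C}).

Fact ker_is_opideal : is_opideal [set x | h x = 0].
Proof.
split=> [|x y|a x|a x|x] /=; first exact: raddf0.
- by move=> hx hy; rewrite raddfD /= hx hy addr0.
- by move=> hx; rewrite rmorphM /= hx mulr0.
- by move=> hx; rewrite rmorphM /= hx mul0r.
- by move=> hx; rewrite morph_oper hx raddf0.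
Qed.

Lemma opideal_span_sub_ker (S : set B) : (forall x, S x -> h x = 0) ->
  forall x, opideal_span S x -> h x = 0.
Proof. by move=> hS x /(_ _ ker_is_opideal hS). Qed.

Lemma opquot_lift (I : opideal B) : (forall x, I x -> h x = 0) ->
  exists g : {opmorphism opquot I -> C}, forall x, g (opquot_pi I x) = h x.
Proof.
move=> hI; pose g (q : opquot I) := h (repr q).
have gE x : g (opquot_pi I x) = h x.
  by apply/subr0_eq; rewrite -[LHS]raddfB; exact/hI/opquot_repr.
have gB : zmod_morphism g.
  move=> p q; rewrite -[p]opquot_reprK -[q]opquot_reprK.
  by rewrite -raddfB !gE raddfB.
have gM : monoid_morphism g.
  split=> [|p q]; first by rewrite -[1]/(opquot_pi I 1) gE rmorph1.
  rewrite -[p]opquot_reprK -[q]opquot_reprK.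
  by rewrite -rmorphM !gE rmorphM.
have gZ : scalable g.
  move=> a p; rewrite -[p]opquot_reprK.
  have -> : a *: opquot_pi I (repr p) = opquot_pi I (a *: repr p).
    exact/esym/opquot_pi_scalable.
  by rewrite !gE linearZ.
have gO : {morph g : x / oper x >-> oper x}.
  by move=> p; rewrite -[p]opquot_reprK -morph_oper !gE morph_oper.
pose m1 := GRing.isZmodMorphism.Build _ _ g gB.
pose m2 := GRing.isMonoidMorphism.Build _ _ g gM.
pose m3 := isPzScalable.Build k _ _ g gZ.
pose m4 := commutesWithOper.Build k _ _ g gO.
pose G : {opmorphism opquot I -> C} := HB.pack g m1 m2 m3 m4.
by exists G.
Qed.

End OpQuotientLift.

(* i exhibits F as the value at A of the left adjoint of the forgetful functor
   to unital algebras from the full subcategory of operated algebras satisfying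
   inC. *)
Definition is_free_in (k : fieldType) (inC : opAlgType k -> Prop)
    (A : pzAlgType k) (F : opAlgType k) (i : {algmorphism A -> F}) : Prop :=
  inC F /\
  forall B : opAlgType k, inC B -> forall f : {algmorphism A -> B},
    exists g : {opmorphism F -> B}, (forall a, g (i a) = f a) /\
      forall h : {opmorphism F -> B}, (forall a, h (i a) = f a) -> h =1 g.

Definition is_free_opalg (k : fieldType) (A : pzAlgType k) (F : opAlgType k)
    (i : {algmorphism A -> F}) : Prop :=
  is_free_in (fun _ => True) i.

Section FreeOpAlgOnAlg.
Variables (k : fieldType) (A : pzAlgType k).

Definition alg_relations : set (freeop k A) :=
  [set r | [\/ r = freeop_var k (1 : A) - 1,
    exists a b : A,
      r = freeop_var k a * freeop_var k b - freeop_var k (a * b) |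
    exists (c : k) (a b : A), r =
      freeop_var k (c *: a + b) - (c *: freeop_var k a + freeop_var k b)]].

Lemma free_opalg_exists :
  exists (F : opAlgType k) (i : {algmorphism A -> F}), is_free_opalg i.
Proof.
pose I := opideal_span alg_relations.
pose i (a : A) : opquot I := opquot_pi I (freeop_var k a).
have relP r : alg_relations r -> I r by move=> hr J _ hJ; exact: hJ.
have iL c a b : i (c *: a + b) = c *: i a + i b.
  have -> : c *: i a = opquot_pi I (c *: freeop_var k a).
    exact/esym/opquot_pi_scalable.
  rewrite /i -raddfD; apply/opquot_piP; apply: relP.
  by apply: Or33; exists c, a, b.
have iB : zmod_morphism i.
  move=> a b; rewrite addrC -scaleN1r iL scaleN1r.
  by rewrite addrC.
have iM : monoid_morphism i.
  split=> [|a b]; first by apply/opquot_piP; apply: relP; exact: Or31.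
  apply/esym; rewrite /i -rmorphM; apply/opquot_piP; apply: relP.
  by apply: Or32; exists a, b.
have iZ : scalable i.
  move=> c a; have := iL c a 0; rewrite !addr0 => ->.
  by have := iB 0 0; rewrite !subrr => ->; rewrite addr0.
pose m1 := GRing.isZmodMorphism.Build _ _ i iB.
pose m2 := GRing.isMonoidMorphism.Build _ _ i iM.
pose m3 := isPzScalable.Build k _ _ i iZ.
pose i' : {algmorphism A -> opquot I} := HB.pack i m1 m2 m3.
exists (opquot I), i'; split=> // B _ f.
have [e [evar eE]] : exists e : {opmorphism freeop k A -> B},
    (forall a, e (freeop_var k a) = f a) /\ e =1 freeop_eval f.
  by exists (freeop_eval f); split=> // a; exact: freeop_eval_var.
have eI x : I x -> e x = 0.
  apply: opideal_span_sub_ker => {}x [->|[a [b ->]]|[c [a [b ->]]]].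
  - by rewrite raddfB /= evar !rmorph1 subrr.
  - by rewrite raddfB /= rmorphM /= !evar rmorphM subrr.
  - rewrite raddfB /= raddfD /= evar raddfD /=.
    have -> : e (c *: freeop_var k a) = c *: e (freeop_var k a).
      exact: (@pzscalable_subproof _ _ _ e c (freeop_var k a)).
    by rewrite !evar linearZ subrr.
have [g gE] := opquot_lift eI.
exists g; split=> [a|h hi q]; first by rewrite gE evar.
rewrite -[q]opquot_reprK gE eE.
pose pi' : {opmorphism freeop k A -> opquot I} := opquot_pi I.
have := @freeop_eval_uniq k A B f (h \o pi'); apply.
by move=> a; rewrite -hi.
Qed.

End FreeOpAlgOnAlg.

Section OPI.
Variables (k : fieldType) (X : choiceType).

(* phi = phi(x_1, ..., x_n) with n >= 1 and x_1, ..., x_n in X distinct.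
   Multilinearity is not required. *)
Definition opi_in (n : nat) (x : n.-tuple X) (phi : freeop k X) : bool :=
  [&& (0 < n)%N, uniq x &
      all (fun w => all (mem x) (bword_vars w)) (msupp phi)].

Definition is_opi (phi : freeop k X) : Prop :=
  exists (n : nat) (x : n.-tuple X), opi_in x phi.

(* phi(r_1, ..., r_n): the morphism used sends x_i to r_i, and the elements of X
   not among the x_i, which do not occur in phi, to 0. *)
Definition opi_value (B : opAlgType k) (n : nat) (x : n.-tuple X)
    (phi : freeop k X) (r : n.-tuple B) : B :=
  freeop_eval (fun y => nth 0 r (index y x)) phi.

Definition is_phialg (Phi : set (freeop k X)) (B : opAlgType k) : Prop :=
  forall phi, Phi phi -> forall (n : nat) (x : n.-tuple X), opi_in x phi ->
    forall r : n.-tuple B, opi_value x phi r = 0.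

Definition phi_relations (Phi : set (freeop k X)) (B : opAlgType k) : set B :=
  [set y | exists phi (n : nat) (x : n.-tuple X) (u : n.-tuple B),
    [/\ Phi phi, opi_in x phi & y = opi_value x phi u]].

End OPI.

Arguments phi_relations {k X} Phi B.

(* Main.v *)
Require Import Defs.
From HB Require Import structures.
From mathcomp Require Import all_boot all_algebra.
From mathcomp Require Import boolp classical_sets.

(** Substitution into an OPI is natural: a morphism [h] of operated algebras
    sends [phi(r_1, ..., r_n)] to [phi(h r_1, ..., h r_n)], because evaluation is
    the unique morphism out of the free operated algebra with given values on
    the variables ([opi_value_morph]).  Both halves of freeness follow.

    The quotient satisfies [Phi]: any arguments in it lift along the projection,
    so by naturality the value of [phi] on them is the class of an element of
    [R_Phi], hence zero ([opquot_is_phialg]).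

    The quotient is universal: if [B] is a [Phi]-algebra, naturality shows that
    every morphism [F -> B] kills [R_Phi], hence the operated ideal it generates,
    and so factors through the quotient ([phialg_factor]).  Applied to the
    extension to [F] of a homomorphism [A -> B], this gives existence; uniqueness
    is that of the extension to [F], as the projection is surjective. *)

Import GRing.Theory.
Local Open Scope ring_scope.

Lemma freeop_eval_comp (k : fieldType) (X : choiceType) (B C : opAlgType k)
    (h : {opmorphism B -> C}) (v : X -> B) (f : freeop k X) :
  h (freeop_eval v f) = freeop_eval (h \o v) f.
Proof.
pose e : {opmorphism freeop k X -> B} := freeop_eval v.
apply: (@freeop_eval_uniq k X C (h \o v) (h \o e)) => x /=.
by rewrite /e /= freeop_eval_var.
Qed.

(** Naturality of substitution.  The two valuations agree on the elements of [X]
    outside [x] as well, since those are sent to [0], which [h] preserves. *)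
Lemma opi_value_morph (k : fieldType) (X : choiceType) (B C : opAlgType k)
    (h : {opmorphism B -> C}) (n : nat) (x : n.-tuple X) (phi : freeop k X)
    (r : n.-tuple B) :
  h (opi_value x phi r) = opi_value x phi (map_tuple h r).
Proof.
rewrite /opi_value freeop_eval_comp; congr (freeop_eval _ phi).
apply/funext => y /=.
have [lt_yr|le_ry] := ltnP (index y x) (size r).
  by rewrite (nth_map 0).
by rewrite !nth_default ?size_map // raddf0.
Qed.

Lemma opquot_is_phialg (k : fieldType) (X : choiceType)
    (Phi : set (freeop k X)) (F : opAlgType k) :
  is_phialg Phi (opquot (opideal_span (phi_relations Phi F))).
Proof.
set I := opideal_span _ => phi Phi_phi n x x_phi r.
pose pi : {opmorphism F -> opquot I} := opquot_pi I.
pose u : n.-tuple F := map_tuple repr r.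
have -> : r = map_tuple pi u.
  by apply: eq_from_tnth => j; rewrite !tnth_map [RHS]opquot_reprK.
rewrite -opi_value_morph -[RHS](raddf0 pi).
apply/opquot_piP; rewrite subr0 => J _; apply.
by exists phi, n, x, u.
Qed.

Lemma phialg_factor (k : fieldType) (X : choiceType) (Phi : set (freeop k X))
    (F B : opAlgType k) (h : {opmorphism F -> B}) : is_phialg Phi B ->
  exists g : {opmorphism opquot (opideal_span (phi_relations Phi F)) -> B},
    forall y, g (opquot_pi _ y) = h y.
Proof.
move=> PhiB; apply/opquot_lift/opideal_span_sub_ker.
move=> _ [phi [n [x [u [Phi_phi x_phi ->]]]]].
by rewrite opi_value_morph PhiB.
Qed.

Theorem proposition4p7 (k : fieldType) (X : choiceType)
  (Phi : set (freeop k X)) (hPhi : forall phi, Phi phi -> is_opi phi)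
  (A : pzAlgType k) (F : opAlgType k) (i : {algmorphism A -> F})
  (hF : is_free_opalg i) :
  is_free_in (is_phialg Phi)
    (opquot_pi (opideal_span (phi_relations Phi F)) \o i).
Proof.
split=> [|B PhiB f]; first exact: opquot_is_phialg.
have [g0 [g0i g0_uniq]] := hF.2 B I f.
have [g gE] := phialg_factor _ _ Phi _ _ g0 PhiB.
exists g; split=> [a|h hi q]; first by rewrite /= gE.
rewrite -[q]opquot_reprK gE.
pose pi : {opmorphism F -> opquot (opideal_span (phi_relations Phi F))} :=
  opquot_pi _.
exact: (g0_uniq (h \o pi)).
Qed.
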